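(* Let $\{\Phi_t\}_{t\in\mathbb R}$ be a family of Hausdorff topological spaces endowed with a bornology $\mathbb B$, and let $U(t,\tau):\Phi_\tau\to\Phi_t$, $t\ge\tau\in\mathbb R$, be a dynamical process which possesses a compact pullback attracting set $\mathcal B=\{\mathcal B(t)\}_{t\in\mathbb R}$ (each $\mathcal B(t)$ is compact in $\Phi_t$). Then the dynamical process $U(t,\tau)$ possesses a pullback attractor $\mathcal A=\{\mathcal A(t)\}_{t\in\mathbb R}$. Moreover, $\mathcal A(t)\subset\mathcal B(t)$ for all $t\in\mathbb R$.
   Context: A dynamical process is a family of maps $U(t,\tau):\Phi_\tau\to\Phi_t$, $\tau\in\mathbb R$, $t\ge\tau$, such that $U(\tau,\tau)=\mathrm{Id}$ and $U(t,s)=U(t,\tau)\circ U(\tau,s)$ for $t\ge\tau\ge s$. No continuity of the maps is assumed. A time-dependent set is a family $B=\{B(t)\}_{t\in\mathbb R}$ with $B(t)\subset\Phi_t$. A bornology $\mathbb B$ is an arbitrary collection of time-dependent sets $B$ such that $B(t)\neq\varnothing$ for every $t\in\mathbb R$. Inclusion of time-dependent sets is understood for every $t$. A time-dependent set $\mathcal B$ is pullback attracting (with respect to $\mathbb B$) if for every $B\in\mathbb B$, every $t\in\mathbb R$ and every neighbourhood $\mathcal O(\mathcal B(t))$ of $\mathcal B(t)$ in $\Phi_t$, there exists $T=T(B,t,\mathcal O)$ such that $U(t,t-s)B(t-s)\subset\mathcal O(\mathcal B(t))$ for all $s\ge T$. A time-dependent set $\mathcal A=\{\mathcal A(t)\}_{t\in\mathbb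 R}$ is a pullback attractor if: 1) $\mathcal A(t)$ is compact in $\Phi_t$ for every $t\in\mathbb R$; 2) $\mathcal A$ is pullback attracting; 3) $\mathcal A$ is a minimal (by inclusion) time-dependent set satisfying 1) and 2). *)

(* Defs.v *)
From HB Require Import structures.
From mathcomp Require Import all_boot all_order all_algebra.
From mathcomp Require Import all_classical all_reals all_analysis.

Set Implicit Arguments.
Unset Strict Implicit.
Unset Printing Implicit Defensive.

Import Order.TTheory GRing.Theory Num.Theory.

Local Open Scope classical_set_scope.
Local Open Scope ring_scope.

(* The map U(t, tau) exists only for tau <= t, hence the proof argument: a
   total family would be too restrictive, since some Phi t may be empty.
   Proofs of the boolean tau <= t are unique, so the value of U(t, tau) does
   not depend on the proof. *)
Record dynamical_process (R : realType) (Phi : R -> topologicalType) :=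
  DynamicalProcess {
    process_map :> forall t tau : R, tau <= t -> Phi tau -> Phi t;
    process_id : forall (t : R) (htt : t <= t), process_map htt =1 id;
    process_comp : forall (t tau s : R)
        (htau : tau <= t) (hs : s <= tau) (hst : s <= t),
      process_map hst =1 process_map htau \o process_map hs
  }.

Arguments process_map {R Phi} _ t tau _ _.

Definition time_set (R : realType) (Phi : R -> topologicalType) :=
  forall t : R, set (Phi t).

Definition time_subset (R : realType) (Phi : R -> topologicalType)
    (A B : time_set Phi) :=
  forall t : R, A t `<=` B t.

Definition bornology (R : realType) (Phi : R -> topologicalType)
    (BB : set (time_set Phi)) :=
  forall B : time_set Phi, BB B -> forall t : R, B t !=set0.

Definition time_compact (R : realType) (Phi : R -> topologicalType)
    (A : time_set Phi) :=
  forall t : R, compact (A t).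

(* The hypothesis hs, equivalent to 0 <= s, only makes U(t, t - s) meaningful;
   it amounts to taking T >= 0. *)
Definition pullback_attracting (R : realType) (Phi : R -> topologicalType)
    (BB : set (time_set Phi)) (U : dynamical_process Phi) (A : time_set Phi) :=
  forall B : time_set Phi, BB B -> forall (t : R) (O : set (Phi t)),
    set_nbhs (A t) O ->
    exists T : R, forall (s : R) (hs : t - s <= t), T <= s ->
      U t (t - s) hs @` B (t - s) `<=` O.

Definition pullback_attractor (R : realType) (Phi : R -> topologicalType)
    (BB : set (time_set Phi)) (U : dynamical_process Phi) (A : time_set Phi) :=
  [/\ time_compact A,
      pullback_attracting BB U A &
      forall C : time_set Phi,
        time_compact C -> pullback_attracting BB U C ->
        time_subset C A -> time_subset A C].

(* Main.v *)
(** A set attracts [B] at time [t] iff all its neighbourhoods belong to the filter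
    generated by the tails of the pullback orbits of [B].  If a compact set
    attracts a filter, then so does every set containing all cluster points of
    the filter, and conversely, by separation, the cluster points belong to every
    compact set attracting the filter.  Hence the closure of the union of the
    cluster (omega-limit) sets is the least compact attracting set. *)
Require Import Defs.
From HB Require Import structures.
From mathcomp Require Import all_boot all_order all_algebra.
From mathcomp Require Import all_classical all_reals all_analysis.

Set Implicit Arguments.
Unset Strict Implicit.
Unset Printing Implicit Defensive.

Import Order.TTheory GRing.Theory Num.Theory.

Local Open Scope classical_set_scope.
Local Open Scope ring_scope.

(** Near each point of [K], some [E] in [F] lies within [O]; compactness makes one [E] serve all of
    [K]. The points [y] with [E y -> O y] then form a neighbourhood of [K], so a member of [F], and
    it meets [E] inside [O]. *)
Lemma set_nbhs_cluster (T : topologicalType) (F : set_system T) (K O : set T) :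
  Filter F -> compact K -> set_nbhs K `<=` F ->
  set_nbhs (K `&` cluster F) O -> F O.
Proof.
move=> FF cptK KF clO.
have [F0|nF0] := pselect (F set0); first exact: filterS F0.
have PF : ProperFilter F by [].
have : \forall E \near powerset_filter_from F,
    K `<=` [set x | nbhs x [set y | E y -> O y]].
  move/compact_near_coveringP : cptK; apply => x Kx.
  suff [V xV [E FE VEO]] :
      exists2 V, nbhs x V & exists2 E, F E & V `&` E `<=` O.
    exists (interior V, [set E' | F E' /\ E' `<=` E]) => /=.
      by split; [exact: nbhs_interior | exact: powerset_filter_fromP].
    move=> [x' E'] [/= x'V [_ E'E]]; apply: filterS x'V => y Vy E'y.
    by apply: VEO; split=> //; exact: E'E.
  (* At a cluster point [O] is itself a neighbourhood; any other point has a neighbourhood missing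
     some [E]. *)
  have [/(conj Kx) /clO xO|] := pselect (cluster F x).
    by exists O => //; exists setT; [exact: filterT | move=> y []].
  move=> /existsNP[E /existsNP[V /not_implyP[FE /not_implyP[xV EV0]]]].
  by exists V => //; exists E => // y [Vy Ey]; case: EV0; exists y.
move=> /near_powerset_filter_fromP [].
  by move=> A B AB KB x /KB; apply: filterS => y BO /AB.
move=> E FE KE; have FW := KF _ KE.
by apply: filterS (filterI FE FW) => y [Ey]; exact.
Qed.

(** If [x] is outside [C], separating it from each point of [C] and using compactness gives one
    neighbourhood of [x] whose complement is a neighbourhood of [C], hence in [F]. *)
Lemma cluster_sub_compact (T : topologicalType) (F : set_system T) (C : set T) :
  hausdorff_space T -> compact C -> set_nbhs C `<=` F -> cluster F `<=` C.
Proof.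
move=> hT cptC CF x clx; apply: contrapT => nCx.
have : \forall V \near powerset_filter_from (nbhs x),
    C `<=` [set y | nbhs y (~` V)].
  move/compact_near_coveringP : cptC; apply => y Cy.
  have /existsNP[V /existsNP[W /not_implyP[xV /not_implyP[yW VW0]]]] :
      ~ cluster (nbhs x) y by move=> /hT xy; apply: nCx; rewrite xy.
  exists (interior W, [set V' | nbhs x V' /\ V' `<=` V]) => /=.
    by split; [exact: nbhs_interior | exact: powerset_filter_fromP].
  move=> [y' V'] [/= y'W [_ V'V]]; apply: filterS y'W => z Wz V'z.
  by apply: VW0; exists z; split=> //; exact: V'V.
move=> /near_powerset_filter_fromP [].
  by move=> A B AB CB y /CB; apply: filterS => z nBz /AB.
by move=> V xV /CF /clx /(_ xV) [z []].
Qed.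

(** Stated so that attraction of [B] at time [t] unfolds to an inclusion of [set_nbhs] in this
    filter. *)
Definition pullback_filter (R : realType) (Phi : R -> topologicalType)
    (U : dynamical_process Phi) (B : time_set Phi) (t : R) :
    set_system (Phi t) :=
  [set O | exists T : R, forall (s : R) (hs : t - s <= t), T <= s ->
    U t (t - s) hs @` B (t - s) `<=` O].

Arguments pullback_filter {R Phi} U B t _.

Lemma pullback_filter_filter (R : realType) (Phi : R -> topologicalType)
    (U : dynamical_process Phi) (B : time_set Phi) (t : R) :
  Filter (pullback_filter U B t).
Proof.
split; first by exists 0.
- move=> P Q [T TP] [S SQ]; exists (Num.max T S) => s hs.
  by rewrite ge_max => /andP[/(TP s hs) UP /(SQ s hs) UQ] y By; split; auto.
- by move=> P Q PQ [T TP]; exists T => s hs Ts; apply: subset_trans PQ; auto.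
Qed.

Theorem theorem5p6 (R : realType) (Phi : R -> topologicalType)
    (hausdorff_Phi : forall t : R, hausdorff_space (Phi t))
    (BB : set (time_set Phi)) (bornology_BB : bornology BB)
    (U : dynamical_process Phi)
    (B : time_set Phi) (compact_B : time_compact B)
    (attracting_B : pullback_attracting BB U B) :
  exists A : time_set Phi,
    pullback_attractor BB U A /\ time_subset A B.
Proof.
pose F (B' : time_set Phi) t := pullback_filter U B' t.
pose A : time_set Phi := fun t => closure (\bigcup_(B' in BB) cluster (F B' t)).
have A_least (C : time_set Phi) :
    time_compact C -> pullback_attracting BB U C -> time_subset A C.
  (* Since [C t] is closed, it is enough to bound the union before closure. *)
  move=> cptC attC t; have /closure_id -> :=
    compact_closed (hausdorff_Phi t) (cptC t).
  apply: closureS => x [B' BB' clx].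
  apply: (cluster_sub_compact (hausdorff_Phi t) (cptC t)) clx.
  exact: attC B' BB' t.
have AB : time_subset A B by exact: A_least.
exists A; split=> //; split.
- move=> t; apply: subclosed_compact (AB t) => //; exact: closed_closure.
- move=> B' BB' t O AO; have FF := pullback_filter_filter U B' t.
  (* Compactness is borrowed from [B t]; [O] surrounds the cluster points of this [B'] because [A t]
     contains them. *)
  apply: (set_nbhs_cluster FF (compact_B t) (attracting_B B' BB' t)).
  by move=> x [_ clx]; apply: AO; apply: subset_closure; exists B'.
- by move=> C cptC attC _; exact: A_least.
Qed.
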